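(* Let $t_0<t_f$ and let $A,S,Q:[t_0,t_f]\to\mathbb{R}^{n\times n}$ be twice continuously differentiable, with $S(t)$ and $Q(t)$ symmetric positive definite for all $t$. Put $$M(t)=\begin{bmatrix}-A(t)^{T}&-Q(t)\\ -S(t)&A(t)\end{bmatrix}\in\mathbb{R}^{2n\times 2n}.$$ Let $c_1,\dots,c_k\in[0,1]$ and $b_1,\dots,b_k>0$ be the nodes and weights of a quadrature rule $\int_{t}^{t+h}g(s)\,ds\approx h\sum_{i=1}^k b_i\,g(t+c_ih)$ of order at least two, and set $$\Psi_h(t)=\exp\Big(h\sum_{i=1}^k b_i\,M(t+c_ih)\Big).$$ Then: 1. (Second order) $\Psi_h(t)=\Phi(t+h,t)+\mathcal{O}(h^3)$ as $h\to0$, where $\Phi(t,s)$ is the fundamental matrix of $y'=M(t)y$ with $\Phi(s,s)=I$. 2. (Unconditional preservation of positivity) For every integer $N\ge1$, with $h=(t_f-t_0)/N$ and $t_j=t_0+jh$, the backward recursion $$\begin{bmatrix}V_j\\ W_j\end{bmatrix}=\Psi_h(t_j)^{-1}\begin{bmatrix}V_{j+1}\\ W_{j+1}\end{bmatrix},\quad j=N-1,\dots,0,\qquad \begin{bmatrix}V_N\\ W_N\end{bmatrix}=\begin{bmatrix}0\\ I\end{bmatrix},$$ has $W_j$ invertible and $\tilde P_j=V_jW_j^{-1}$ symmetric positive definite for all $0\le j\le N-1$. In particular, this holds for the midpoint rule $\Psi_h(t)=\exp(hM(t+h/2))$ and for the trapezoidal rule $\Psi_h(t)=\exp\big(\tfrac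 h2[M(t+h)+M(t)]\big)$.
   Context: The method is the second order Magnus integrator, i.e. the truncation of the Magnus expansion after its first term $\Omega_1(t+h,t)=\int_t^{t+h}M(s)\,ds$ with the integral replaced by quadrature. It approximates the matrix Riccati equation $\dot P=-PA(t)-A(t)^{T}P+PS(t)P-Q(t)$, $P(t_f)=0$, through $P(t)=V(t)W(t)^{-1}$, where $\frac{d}{dt}\begin{bmatrix}V\\ W\end{bmatrix}=M(t)\begin{bmatrix}V\\ W\end{bmatrix}$, $V(t_f)=0$, $W(t_f)=I$; the approximations are $\tilde P_j\approx P(t_j)$. A quadrature rule of order at least two is one that is exact for polynomials of degree at most one, i.e. $\sum_i b_i=1$ and $\sum_i b_ic_i=\tfrac12$. *)

(* Defs.v *)
From HB Require Import structures.
From mathcomp Require Import all_boot all_order all_algebra.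
From mathcomp Require Import all_classical all_reals all_analysis.
Set Implicit Arguments.
Unset Strict Implicit.
Unset Printing Implicit Defensive.
Import Order.TTheory GRing.Theory Num.Theory.
Import numFieldNormedType.Exports.
Local Open Scope classical_set_scope.
Local Open Scope ring_scope.

(* The exponential series, summed in the (complete) topology of 'M[R]_n. *)
Definition expm (R : realType) (n : nat) (X : 'M[R]_n) : 'M[R]_n :=
  lim (series (fun k : nat => (k`!%:R)^-1 *: X ^+ k) @ \oo).

Definition posdefmx (R : realType) (n : nat) (X : 'M[R]_n) : Prop :=
  X^T = X /\ forall x : 'cV[R]_n, x != 0 -> 0 < (x^T *m X *m x) 0 0.

(* Derivative relative to D: at an endpoint of a closed interval D this is
   the one-sided derivative, and the values of f outside D are irrelevant. *)
Definition has_deriv_in (R : realType) (m n : nat) (D : set R)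
    (f : R -> 'M[R]_(m, n)) (df : 'M[R]_(m, n)) (t : R) : Prop :=
  (s - t)^-1 *: (f s - f t) @[s --> within D t^'] --> df.

Definition C2_in (R : realType) (m n : nat) (D : set R)
    (f : R -> 'M[R]_(m, n)) : Prop :=
  exists f1 f2 : R -> 'M[R]_(m, n),
    [/\ forall t, D t -> has_deriv_in D f (f1 t) t,
        forall t, D t -> has_deriv_in D f1 (f2 t) t
      & {within D, continuous f2}].

Definition riccati_mx (R : realType) (n : nat) (A S Q : R -> 'M[R]_n) (t : R) :
    'M[R]_(n + n) :=
  block_mx (- (A t)^T) (- Q t) (- S t) (A t).

(* Phi t s is the fundamental matrix of y' = M(t) y on D, with
   Phi s s = I. *)
Definition fundamental_mx (R : realType) (n : nat) (D : set R)
    (M : R -> 'M[R]_n) (Phi : R -> R -> 'M[R]_n) : Prop :=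
  forall s, D s -> Phi s s = 1%:M /\
    forall t, D t -> has_deriv_in D (fun u => Phi u s) (M t *m Phi t s) t.

(* Nodes c and weights b on the reference interval [0, 1]; the last two
   conditions are exactness on polynomials of degree at most one. *)
Definition quadrature_order2 (R : realType) (k : nat) (c b : 'I_k -> R) : Prop :=
  [/\ forall i, 0 <= c i <= 1, forall i, 0 < b i,
      \sum_(i < k) b i = 1 & \sum_(i < k) b i * c i = 2^-1].

Definition magnus_step (R : realType) (n k : nat) (c b : 'I_k -> R)
    (M : R -> 'M[R]_n) (h t : R) : 'M[R]_n :=
  expm (h *: \sum_(i < k) b i *: M (t + c i * h)).

Definition midpoint_step (R : realType) (n : nat)
    (M : R -> 'M[R]_n) (h t : R) : 'M[R]_n :=
  expm (h *: M (t + h / 2)).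

Definition trapezoidal_step (R : realType) (n : nat)
    (M : R -> 'M[R]_n) (h t : R) : 'M[R]_n :=
  expm ((h / 2) *: (M (t + h) + M t)).

(* Psi h t = Phi (t + h) t + O(h^3) as h -> 0, with constants uniform in t;
   only steps staying inside [t0, tf] are considered, and h may have either
   sign. *)
Definition second_order (R : realType) (n : nat) (t0 tf : R)
    (M : R -> 'M[R]_n) (Psi : R -> R -> 'M[R]_n) : Prop :=
  forall Phi : R -> R -> 'M[R]_n, fundamental_mx `[t0, tf] M Phi ->
  exists C : R, \forall h \near (0 : R), forall t : R,
    t0 <= t <= tf -> t0 <= t + h <= tf ->
    `|Psi h t - Phi (t + h) t| <= C * `|h| ^+ 3.

Definition preserves_positivity (R : realType) (n : nat) (t0 tf : R)
    (Psi : R -> R -> 'M[R]_(n + n)) : Prop :=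
  forall (N : nat) (V W : nat -> 'M[R]_n), (1 <= N)%N ->
  let h := (tf - t0) / N%:R in
  V N = 0 -> W N = 1%:M ->
  (forall j, (j < N)%N ->
     col_mx (V j) (W j) =
     invmx (Psi h (t0 + j%:R * h)) *m col_mx (V j.+1) (W j.+1)) ->
  forall j, (j < N)%N ->
    W j \in unitmx /\ posdefmx (V j *m invmx (W j)).

(* Main.v *)
Require Import Defs.
From mathcomp Require Import all_boot all_order all_algebra.
From mathcomp Require Import all_classical all_reals all_analysis.
From mathcomp Require Import ring lra.
Set Implicit Arguments.
Unset Strict Implicit.
Unset Printing Implicit Defensive.
Import Order.TTheory GRing.Theory Num.Theory.
Import numFieldNormedType.Exports.
Local Open Scope classical_set_scope.
Local Open Scope ring_scope.

(** Second order.  On the segment between [t] and [t + h] the solution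
    [Y = Phi _ t] is bounded by 2 for small [h], because at a point where
    [`|Y|] is largest the mean value inequality gives
    [`|Y| <= 1 + `|Y| / 2].  Feeding one estimate into the next through
    [Y' = M Y] and the mean value inequality yields
    [Y = 1 + h M + h^2/2 (M' + M^2) + O(h^3)] with constants that depend only
    on the size of [M], [M'], [M''] ([linear_ode_taylor2]); neither existence of
    [Phi] nor a third derivative is needed.  On the other side the order
    conditions give
    [h \sum_i b_i M(t + c_i h) = h M + h^2/2 M' + O(h^3)], and the exponential
    series gives the same expansion ([expm_taylor2], [magnus_step_taylor2]).

    Positivity.  One backward step is [y |-> exp (- h B) y] where [B] is a
    positive combination of the matrices [M (t + c_i h)], hence again of the
    form [block_mx (- a^T) (- q) (- s) a] with [s], [q] symmetric positive
    definite.  Along [y' = - B y], [y = (v, w)], the quantity [v^T w] has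
    derivative [v^T s v + w^T q w], so it strictly increases unless [y = 0], and
    [V^T W - W^T V] is constant ([riccati_step_form]).  Starting from
    [V^T W = 0], every backward iterate thus has [V^T W] symmetric positive
    definite, which forces [W] to be invertible and makes [V W^-1] congruent to
    [V^T W] ([posdefmx_frame]).

    The midpoint and trapezoidal rules are the quadrature rules with one and two
    nodes. *)

(** * The entrywise maximum norm on matrices *)

Section MxNorm.
Variable R : realType.

Lemma mx_norm_leP (m n : nat) (X : 'M[R]_(m, n)) (e : R) : 0 <= e ->
  `|X| <= e <-> forall i j, `|X i j| <= e.
Proof.
move=> e0; rewrite {1}/Num.Def.normr /= mx_normrE; split=> [Xe i j|Xe].
- by apply: le_trans Xe; exact: (le_bigmax _ (fun ij => `|X ij.1 ij.2|) (i, j)).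
- by apply: bigmax_le => // -[i j] _; exact: Xe.
Qed.

Lemma ler_mx_norm_entry (m n : nat) (X : 'M[R]_(m, n)) i j : `|X i j| <= `|X|.
Proof. by have /mx_norm_leP := lexx `|X|; apply. Qed.

(** The maximum norm is submultiplicative only up to the inner dimension. *)
Lemma ler_norm_mulmx (m n p : nat) (X : 'M[R]_(m, n)) (Y : 'M[R]_(n, p)) :
  `|X *m Y| <= n%:R * `|X| * `|Y|.
Proof.
apply/mx_norm_leP => [|i j]; first by rewrite !mulr_ge0.
rewrite mxE (le_trans (ler_norm_sum _ _ _))//.
have -> : n%:R * `|X| * `|Y| = \sum_(k < n) `|X| * `|Y|.
  by rewrite sumr_const card_ord -mulrA mulr_natl.
apply: ler_sum => k _.
by rewrite normrM ler_pM// ler_mx_norm_entry.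
Qed.

Lemma ler_norm_mulmx_le (m n p : nat) (X : 'M[R]_(m, n)) (Y : 'M[R]_(n, p)) x y :
  `|X| <= x -> `|Y| <= y -> `|X *m Y| <= n%:R * x * y.
Proof.
move=> Xx Yy; rewrite (le_trans (ler_norm_mulmx _ _))//.
by rewrite ler_pM ?mulr_ge0// ler_wpM2l.
Qed.

Lemma ler_norm_scalar_mx1 (n : nat) : `|1%:M : 'M[R]_n| <= 1.
Proof.
apply/mx_norm_leP => // i j; rewrite mxE.
by case: (i == j); rewrite ?normr1 ?normr0.
Qed.

Lemma cvg_mxP (T : Type) (F : set_system T) (m n : nat) (f : T -> 'M[R]_(m, n))
    (L : 'M[R]_(m, n)) : Filter F ->
  (f x @[x --> F] --> L) <-> (forall i j, f x i j @[x --> F] --> L i j).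
Proof.
move=> FF; split=> [fL i j|fL].
  apply: (@cvg_comp _ _ _ f (fun M : 'M[R]_(m, n) => M i j)) fL _.
  exact: coord_continuous.
apply/cvgrPdist_le => /= e e0; near=> x.
apply/mx_norm_leP => [|i j]; first exact: ltW.
rewrite !mxE; move: i j; near: x.
apply: filter_forall => i; apply: filter_forall => j.
exact: ((cvgrPdist_le _ _).1 (fL i j)).
Unshelve. all: by end_near. Qed.

Lemma cvg_mulmx (T : Type) (F : set_system T) {FF : Filter F} (m n p : nat)
    (f : T -> 'M[R]_(m, n)) (g : T -> 'M[R]_(n, p))
    (A : 'M[R]_(m, n)) (B : 'M[R]_(n, p)) :
  f x @[x --> F] --> A -> g x @[x --> F] --> B ->
  f x *m g x @[x --> F] --> A *m B.
Proof.
move=> /cvg_mxP fA /cvg_mxP gB; apply/cvg_mxP => i j.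
rewrite mxE; under eq_fun do rewrite mxE.
apply: cvg_big => [|k _]; first exact: add_continuous.
by apply: cvgM; [exact: fA | exact: gB].
Qed.

End MxNorm.

(** * Derivatives of matrix functions relative to a set *)

Section Derivative.
Variable R : realType.
Implicit Types (D : set R) (t : R).

Lemma has_deriv_in_entry (m n : nat) D (f : R -> 'M[R]_(m, n)) df t :
  has_deriv_in D f df t <->
  forall i j, (s - t)^-1 * (f s i j - f t i j) @[s --> within D t^'] --> df i j.
Proof.
rewrite /has_deriv_in cvg_mxP.
by split=> H i j; have := H i j; [|move=> Hij]; under eq_fun do rewrite !mxE.
Qed.

Lemma near_within_dnbhs_neq D t : \forall s \near within D t^', s != t.
Proof.
have : \forall s \near t, s != t -> D s -> s != t by near=> s.
exact.
Unshelve. all: by end_near. Qed.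

Lemma has_deriv_in_sub (m n : nat) D D' (f : R -> 'M[R]_(m, n)) df t :
  D' `<=` D -> has_deriv_in D f df t -> has_deriv_in D' f df t.
Proof. by move=> DD'; apply: cvg_trans; apply: cvg_app; exact: within_subset. Qed.

Lemma has_deriv_in_cvg (m n : nat) D (f : R -> 'M[R]_(m, n)) df t :
  has_deriv_in D f df t -> f s @[s --> within D t^'] --> f t.
Proof.
move=> fdf; have st : (s - t) @[s --> within D t^'] --> (0 : R).
  rewrite -(subrr t); apply: cvgB; last exact: cvg_cst.
  by do 2 apply: cvg_within_filter; exact: cvg_id.
have : (s - t) *: ((s - t)^-1 *: (f s - f t)) + f t @[s --> within D t^']
    --> 0 *: df + f t.
  by apply: cvgD; [exact: cvgZ | exact: cvg_cst].
rewrite scale0r add0r; apply: cvg_trans; apply: near_eq_cvg.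
near=> s; have st0 : s - t != 0.
  by rewrite subr_eq0; near: s; exact: near_within_dnbhs_neq.
by rewrite /= scalerA divff// scale1r subrK.
Unshelve. all: by end_near. Qed.

(** A derivative relative to [D] only controls [f] along points of [D] other
    than [t]; adding [t] itself gives continuity in the subspace topology. *)
Lemma has_deriv_in_within_continuous (m n : nat) D (f df : R -> 'M[R]_(m, n)) :
  (forall t, D t -> has_deriv_in D f (df t) t) -> {within D, continuous f}.
Proof.
move=> fdf; apply/subspace_continuousP => t Dt.
have /cvgrPdist_le ft := has_deriv_in_cvg (fdf t Dt).
apply/cvgrPdist_le => e e0.
have H : \forall s \near t, s != t -> D s -> `|f t - f s| <= e by exact: ft.
suff : \forall s \near t, D s -> `|f t - f s| <= e by [].
apply: filterS H => s H Ds.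
have [->|st] := eqVneq s t; first by rewrite subrr normr0 ltW.
exact: H.
Qed.

Lemma has_deriv_in_cst (m n : nat) D (C : 'M[R]_(m, n)) t :
  has_deriv_in D (fun=> C) 0 t.
Proof.
rewrite /has_deriv_in; under eq_fun do rewrite subrr scaler0.
exact: cvg_cst.
Qed.

Lemma has_deriv_inD (m n : nat) D (f g : R -> 'M[R]_(m, n)) df dg t :
  has_deriv_in D f df t -> has_deriv_in D g dg t ->
  has_deriv_in D (fun s => f s + g s) (df + dg) t.
Proof.
move=> fdf gdg; rewrite /has_deriv_in.
under eq_fun do rewrite opprD addrACA scalerDr.
exact: cvgD.
Qed.

Lemma has_deriv_inN (m n : nat) D (f : R -> 'M[R]_(m, n)) df t :
  has_deriv_in D f df t -> has_deriv_in D (fun s => - f s) (- df) t.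
Proof.
move=> fdf; rewrite /has_deriv_in.
under eq_fun do rewrite -opprD scalerN.
exact: cvgN.
Qed.

Lemma has_deriv_in_tr (m n : nat) D (f : R -> 'M[R]_(m, n)) df t :
  has_deriv_in D f df t -> has_deriv_in D (fun s => (f s)^T) df^T t.
Proof.
move=> /has_deriv_in_entry fdf; apply/has_deriv_in_entry => i j.
by rewrite [df^T _ _]mxE; under eq_fun do rewrite !mxE; exact: fdf.
Qed.

Lemma has_deriv_in_mulmx (m n p : nat) D (f : R -> 'M[R]_(m, n))
    (g : R -> 'M[R]_(n, p)) df dg t :
  has_deriv_in D f df t -> has_deriv_in D g dg t ->
  has_deriv_in D (fun s => f s *m g s) (df *m g t + f t *m dg) t.
Proof.
move=> fdf gdg; rewrite /has_deriv_in.
have E s : (s - t)^-1 *: (f s *m g s - f t *m g t) =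
    ((s - t)^-1 *: (f s - f t)) *m g s + f t *m ((s - t)^-1 *: (g s - g t)).
  by rewrite -scalemxAl -scalemxAr -scalerDr mulmxBl mulmxBr addrA subrK.
under eq_fun do rewrite E.
apply: cvgD; apply: cvg_mulmx => //; first exact: has_deriv_in_cvg gdg.
exact: cvg_cst.
Qed.

Lemma has_deriv_in_scale_shift (m n : nat) D (a : R) (f : R -> 'M[R]_(m, n)) df t :
  has_deriv_in D f df t ->
  has_deriv_in D (fun s => (s - a) *: f s) (f t + (t - a) *: df) t.
Proof.
move=> fdf; rewrite /has_deriv_in.
have : f s + (t - a) *: ((s - t)^-1 *: (f s - f t)) @[s --> within D t^']
    --> f t + (t - a) *: df.
  apply: cvgD; first exact: has_deriv_in_cvg fdf.
  by apply: cvgZ => //; exact: cvg_cst.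
apply: cvg_trans; apply: near_eq_cvg; near=> s; have st0 : s - t != 0.
  by rewrite subr_eq0; near: s; exact: near_within_dnbhs_neq.
rewrite /=; apply: (scalerI st0).
rewrite scalerDr [_ *: (_ *: (_^-1 *: _))]scalerA (mulrC (s - t)) -scalerA.
rewrite !(scalerA (s - t)) divff// !scale1r scalerBr addrA -scalerDl.
by rewrite addrA subrK.
Unshelve. all: by end_near. Qed.

End Derivative.

(** * Mean value theorems on a segment *)

Section MeanValue.
Variable R : realType.

(** When [D] is a neighbourhood of [t] the relative derivative is the
    two-sided one. *)
Lemma has_deriv_in_is_derive (m n : nat) (D : set R) (f : R -> 'M[R]_(m, n)) df t i j :
  nbhs t D -> has_deriv_in D f df t ->
  is_derive t 1 (fun s => f s i j) (df i j).
Proof.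
move=> tD /has_deriv_in_entry/(_ i j)/cvgrPdist_le fdf.
have L : h^-1 *: (f (h *: 1 + t) i j - f t i j) @[h --> 0^'] --> df i j.
  apply/cvgrPdist_le => e e0.
  have H : \forall s \near t, s != t -> D s ->
      `|df i j - (s - t)^-1 * (f s i j - f t i j)| <= e by exact: fdf.
  have [r /= r0 rH] := filterI tD H.
  near=> h; have [|Dh] := rH (h + t).
    rewrite /= opprD addrCA subrr addr0 normrN.
    by near: h; exact: dnbhs0_lt.
  rewrite addrK [h *: 1]mulr1; apply => //.
  by rewrite -subr_eq0 addrK; near: h; exact: nbhs_dnbhs_neq.
by apply: DeriveDef; [apply/cvg_ex; exists (df i j) | exact: cvg_lim L].
Unshelve. all: by end_near. Qed.

(** The mean value theorem holds for each entry separately, with an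
    intermediate point that depends on the entry. *)
Lemma mx_MVT (m n : nat) (a b : R) (f df : R -> 'M[R]_(m, n)) i j : a < b ->
  (forall t, `[a, b]%classic t -> has_deriv_in `[a, b]%classic f (df t) t) ->
  exists2 c, `[a, b]%classic c & f b i j - f a i j = df c i j * (b - a).
Proof.
move=> ab fdf.
have [||c cab E] := @MVT _ (fun s => f s i j) (fun s => df s i j) a b ab.
- move=> t tab; apply: (@has_deriv_in_is_derive _ _ `[a, b]).
    by apply: filterS (near_in_itvoo tab) => s; exact: subset_itv_oo_cc.
  by apply: fdf; exact: subset_itv_oo_cc.
- have := has_deriv_in_within_continuous fdf.
  move=> /subspace_continuousP fc; apply/subspace_continuousP => t tab.
  by have /cvg_mxP := fc t tab; apply.
by exists c => //; exact: subset_itv_oo_cc.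
Qed.

Lemma mx_mean_value_le (m n : nat) (a b C : R) (f df : R -> 'M[R]_(m, n)) :
  (forall t, `[a, b]%classic t -> has_deriv_in `[a, b]%classic f (df t) t) ->
  (forall t, `[a, b]%classic t -> `|df t| <= C) ->
  forall s t, `[a, b]%classic s -> `[a, b]%classic t -> `|f s - f t| <= C * `|s - t|.
Proof.
move=> fdf dfC s t; wlog ts : s t / t <= s.
  move=> H; have [ts|/ltW st] := leP t s; first exact: H.
  by move=> sD tD; rewrite distrC (distrC s); exact: H.
move=> sD tD; move: ts; rewrite le_eqVlt => /predU1P[->|ts].
  by rewrite !subrr !normr0 mulr0.
have C0 : 0 <= C by exact: le_trans (dfC t tD).
apply/mx_norm_leP => [|i j]; first by rewrite mulr_ge0.
have tsD : `[t, s]%classic `<=` `[a, b]%classic.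
  apply: subset_itvScc; rewrite /= bnd_simp.
    by move: tD; rewrite /= in_itv => /andP[].
  by move: sD; rewrite /= in_itv => /andP[].
have [|c cts E] := @mx_MVT _ _ t s f df i j ts.
  by move=> x /tsD xD; apply: has_deriv_in_sub tsD _; exact: fdf.
rewrite !mxE E normrM ler_wpM2r// (le_trans (ler_mx_norm_entry _ _ _))//.
by apply: dfC; exact: tsD.
Qed.

Lemma within_continuous_mx_bounded (m n : nat) (a b : R) (f : R -> 'M[R]_(m, n)) :
  a <= b -> {within `[a, b], continuous f} ->
  exists2 c, `[a, b]%classic c & forall t, `[a, b]%classic t -> `|f t| <= `|f c|.
Proof.
move=> ab fc; apply: (@EVT_max R (fun t => `|f t|) a b ab).
by move=> t; apply: continuous_comp; [exact: fc | exact: norm_continuous].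
Qed.

End MeanValue.

(** * The matrix exponential *)

Section Exponential.
Variables (R : realType) (n : nat).
Implicit Types X B : 'M[R]_n.

Lemma scalemx_exp (a : R) X k : (a *: X) ^+ k = a ^+ k *: X ^+ k.
Proof.
elim: k => [|k IH]; first by rewrite !expr0 scale1r.
rewrite !exprS IH -!mulmxE -scalemxAl -scalemxAr scalerA.
by rewrite -exprS.
Qed.

Lemma ler_norm_mx_exp X k : `|X ^+ k| <= (n%:R * `|X|) ^+ k.
Proof.
elim: k => [|k IH]; first by rewrite !expr0; exact: ler_norm_scalar_mx1.
rewrite !exprS -mulmxE (le_trans (ler_norm_mulmx _ _))//.
by rewrite ler_wpM2l// mulr_ge0.
Qed.

(** The coefficients of the power series [u |-> expm (u *: B) i j]. *)
Definition expm_coef B i j (k : nat) : R := (k`!%:R)^-1 * (B ^+ k) i j.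

Lemma series_expm_entry B (u : R) i j N :
  series (fun k => (k`!%:R)^-1 *: (u *: B) ^+ k) N i j =
  pseries (expm_coef B i j) u N.
Proof.
rewrite /pseries /series /= summxE; apply: eq_bigr => k _.
by rewrite scalemx_exp !mxE /expm_coef -[RHS]mulrA; congr (_ * _); rewrite mulrC.
Qed.

Lemma is_cvg_expm_coef B i j (u : R) : cvgn (pseries (expm_coef B i j) u).
Proof.
apply: normed_cvg; apply: (@series_le_cvg _ _ (exp_coeff (n%:R * `|B| * `|u|))).
- by move=> k /=.
- by move=> k; rewrite /exp_coeff /= divr_ge0// exprn_ge0// !mulr_ge0.
- move=> k; rewrite /exp_coeff /expm_coef /= normrM normrM normrX.
  rewrite normfV normr_nat -mulrA mulrC ler_wpM2r ?invr_ge0// exprMn.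
  rewrite ler_wpM2r ?exprn_ge0// (le_trans (ler_mx_norm_entry _ _ _))//.
  exact: ler_norm_mx_exp.
- exact: is_cvg_series_exp_coeff.
Qed.

Lemma pseries_diffs_expm_coef B i j :
  pseries_diffs (expm_coef B i j) = fun k => (k`!%:R)^-1 * (B ^+ k.+1) i j.
Proof.
apply/funext => k; rewrite /pseries_diffs /expm_coef factS natrM invfM.
by rewrite !mulrA divff ?mul1r// pnatr_eq0.
Qed.

(** Termwise differentiation of the series of [expm (u *: B)] amounts to left
    multiplication by [B]; this also expresses the second derived series
    through convergent ones. *)
Lemma pseries_diffs_expm_sum B i j :
  pseries_diffs (expm_coef B i j) = fun k => \sum_l B i l * expm_coef B l j k.
Proof.
rewrite pseries_diffs_expm_coef; apply/funext => k.
rewrite exprS -mulmxE mxE mulr_sumr; apply: eq_bigr => l _.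
by rewrite mulrCA.
Qed.

Lemma cvg_expm B (u : R) :
  series (fun k => (k`!%:R)^-1 *: (u *: B) ^+ k) @ \oo --> expm (u *: B).
Proof.
have cvE : series (fun k => (k`!%:R)^-1 *: (u *: B) ^+ k) @ \oo -->
    \matrix_(i, j) limn (pseries (expm_coef B i j) u).
  apply/cvg_mxP => i j; rewrite mxE.
  by under eq_fun do rewrite series_expm_entry; exact: is_cvg_expm_coef.
by rewrite /expm (cvg_lim _ cvE).
Qed.

Lemma expm_entry B (u : R) i j :
  expm (u *: B) i j = limn (pseries (expm_coef B i j) u).
Proof.
have /cvg_mxP/(_ i j) := @cvg_expm B u.
by under eq_fun do rewrite series_expm_entry; move=> /cvg_lim <-.
Qed.

Lemma cvg_pseries_sum (a : 'I_n -> R) (c : 'I_n -> R ^nat) (L : 'I_n -> R) (u : R) :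
  (forall l, pseries (c l) u @ \oo --> L l) ->
  pseries (fun k => \sum_l a l * c l k) u @ \oo --> \sum_l a l * L l.
Proof.
move=> cL; have -> : pseries (fun k => \sum_l a l * c l k) u =
    fun N => \sum_l a l * pseries (c l) u N.
  apply/funext => N; rewrite /pseries /series /=.
  under [RHS]eq_bigr do rewrite mulr_sumr.
  rewrite exchange_big /=; apply: eq_bigr => k _; rewrite mulr_suml.
  by apply: eq_bigr => l _; rewrite mulrA.
apply: cvg_big => [|l _]; first exact: add_continuous.
by apply: cvgM; [exact: cvg_cst | exact: cL].
Qed.

Lemma cvg_pseries_diffs_expm B i j (u : R) :
  pseries (pseries_diffs (expm_coef B i j)) u @ \oo --> (B *m expm (u *: B)) i j.
Proof.
rewrite pseries_diffs_expm_sum mxE; apply: cvg_pseries_sum => l.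
by rewrite expm_entry; exact: is_cvg_expm_coef.
Qed.

Lemma is_cvg_pseries_diffs2_expm B i j (u : R) :
  cvgn (pseries (pseries_diffs (pseries_diffs (expm_coef B i j))) u).
Proof.
have -> : pseries_diffs (pseries_diffs (expm_coef B i j)) =
    fun k => \sum_l B i l * pseries_diffs (expm_coef B l j) k.
  rewrite pseries_diffs_expm_sum; apply/funext => k.
  rewrite /pseries_diffs mulr_sumr; apply: eq_bigr => l _.
  by rewrite mulrCA.
by apply/cvg_ex; eexists; apply: cvg_pseries_sum => l; exact: cvg_pseries_diffs_expm.
Qed.

Lemma is_derive_expm_entry B i j (u : R) :
  is_derive u 1 (fun v => expm (v *: B) i j) ((B *m expm (u *: B)) i j).
Proof.
have -> : (fun v => expm (v *: B) i j) =
    (fun v => limn (pseries (expm_coef B i j) v)).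
  by apply/funext => v; rewrite expm_entry.
have /cvg_lim <- // := @cvg_pseries_diffs_expm B i j u.
apply: (@pseries_snd_diffs _ _ (`|u| + 1)).
- exact: is_cvg_expm_coef.
- by apply/cvg_ex; eexists; exact: cvg_pseries_diffs_expm.
- exact: is_cvg_pseries_diffs2_expm.
- by rewrite (@ger0_norm _ (`|u| + 1)) ?addr_ge0// ltrDl.
Qed.

Lemma has_deriv_in_expm D B (u : R) :
  has_deriv_in D (fun v => expm (v *: B)) (B *m expm (u *: B)) u.
Proof.
apply/has_deriv_in_entry => i j.
have [+ <-] := is_derive_expm_entry B i j u.
rewrite /derivable /derive => /cvgrPdist_le H; apply/cvgrPdist_le => e e0.
have [r /= r0 rH] := H e e0.
suff : \forall s \near u, s != u -> D s ->
   `|lim (h^-1 *: ((expm ((h *: 1 + u) *: B)) i j - expm (u *: B) i j) @[h --> 0^']) -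
     (s - u)^-1 * (expm (s *: B) i j - expm (u *: B) i j)| <= e by [].
near=> s => su Ds; have := rH (s - u).
rewrite /= sub0r normrN [(s - u) *: 1]mulr1 subrK; apply; last by rewrite subr_eq0.
by rewrite distrC; near: s; exists r.
Unshelve. all: by end_near. Qed.

Lemma expm0 : expm (0 : 'M[R]_n) = 1%:M.
Proof.
rewrite /expm; apply: cvg_lim => //.
apply: cvg_near_cst; near=> N.
have -> : N = N.-1.+1 by rewrite prednK//; near: N; exact: nbhs_infty_gt.
rewrite seriesEord/= big_ord_recl expr0 invr1 scale1r big1 ?addr0// => k _.
by rewrite expr0n scaler0.
Unshelve. all: by end_near. Qed.

Lemma expm_comm B (u : R) : expm (u *: B) *m B = B *m expm (u *: B).
Proof.
pose S := series (fun k => (k`!%:R)^-1 *: (u *: B) ^+ k).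
have cl : S N *m B @[N --> \oo] --> expm (u *: B) *m B.
  by apply: cvg_mulmx; [exact: cvg_expm | exact: cvg_cst].
have cr : B *m S N @[N --> \oo] --> B *m expm (u *: B).
  by apply: cvg_mulmx; [exact: cvg_cst | exact: cvg_expm].
rewrite -(cvg_lim _ cl)// -(cvg_lim _ cr)//; congr (lim (_ @ \oo)).
apply/funext => N; rewrite /S /series mulmx_suml mulmx_sumr.
apply: eq_bigr => k _; rewrite scalemx_exp -!(scalemxAl, scalemxAr).
by rewrite !mulmxE -exprSr exprS.
Qed.

(** [u |-> expm (u *: B) *m expm (- u *: B)] has zero derivative, hence stays
    equal to its value at [0]. *)
Lemma mulmx_expmN B : expm B *m expm (- B) = 1%:M.
Proof.
pose G (u : R) := expm (u *: B) *m expm (u *: - B).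
have dG u : has_deriv_in `[0, 1] G 0 u.
  have -> : 0 = (B *m expm (u *: B)) *m expm (u *: - B) +
      expm (u *: B) *m (- B *m expm (u *: - B)).
    by rewrite mulNmx mulmxN mulmxA expm_comm subrr.
  by apply: has_deriv_in_mulmx; exact: has_deriv_in_expm.
have : `|G 1 - G 0| <= 0 * `|1 - 0|.
  apply: (@mx_mean_value_le R n n 0 1 0 G (fun=> 0)) => [u _|u _||] //=.
  - by rewrite normr0.
  - by rewrite in_itv /= ler01 lexx.
  - by rewrite in_itv /= ler01 lexx.
rewrite mul0r normr_le0 subr_eq0 /G !scale1r !scale0r expm0 mulmx1.
by move/eqP.
Qed.

Lemma invmx_expm B : invmx (expm B) = expm (- B).
Proof.
have E := mulmx_expmN B; have [Bu _] := mulmx1_unit E.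
by rewrite -[LHS]mulmx1 -E mulKmx.
Qed.

Lemma expm_unit B : expm B \in unitmx.
Proof. by have [] := mulmx1_unit (mulmx_expmN B). Qed.

(** The hypothesis [`|X| <= 1] only serves to bound the exponential of
    [n%:R * `|X|] by a constant. *)
Lemma expm_taylor2 X : `|X| <= 1 ->
  `|expm X - (1%:M + X + 2^-1 *: (X *m X))| <= n%:R ^+ 3 * expR n%:R * `|X| ^+ 3.
Proof.
move=> X1; set T := _ + _ *: _.
have r0 : 0 <= n%:R * `|X| by rewrite mulr_ge0.
have cv : `|series (fun k => (k`!%:R)^-1 *: (1 *: X) ^+ k) N - T| @[N --> \oo]
    --> `|expm (1 *: X) - T|.
  by apply: cvg_norm; apply: cvgB; [exact: cvg_expm | exact: cvg_cst].
rewrite scale1r in cv; apply: (cvgr_to_le cv); near=> N.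
have [m ->] : exists m, N = (3 + m)%N.
  by exists (N - 3)%N; rewrite subnKC//; near: N; exact: nbhs_infty_ge.
rewrite seriesEord/= big_split_ord /= 3!big_ord_recl big_ord0 /=.
rewrite addr0 expr0 expr1 invr1 !scale1r expr2 addrA -[_ + _ + _ *: _]/T.
rewrite [T + _]addrC addrK.
have H k : `|((3 + k)`!%:R)^-1 *: X ^+ (3 + k)| <=
    (n%:R * `|X|) ^+ 3 * exp_coeff (n%:R * `|X|) k.
  rewrite normrZ ger0_norm ?invr_ge0// /exp_coeff /= mulrA -exprD mulrC.
  rewrite ler_pM ?invr_ge0//; first exact: ler_norm_mx_exp.
  by rewrite lef_pV2 ?posrE ?ltr0n ?fact_gt0// ler_nat leq_fact// leq_addl.
rewrite (le_trans (ler_norm_sum _ _ _))//.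
apply: (@le_trans _ _ ((n%:R * `|X|) ^+ 3 * expR (n%:R * `|X|))).
  rewrite (le_trans (ler_sum _ (fun (k : 'I_m) _ => H k)))// -mulr_sumr.
  rewrite ler_wpM2l ?exprn_ge0//.
  have nd : {homo series (exp_coeff (n%:R * `|X|)) : k l / (k <= l)%N >-> k <= l}.
    apply: nondecreasing_series => k _ _.
    by rewrite /exp_coeff /= divr_ge0// exprn_ge0.
  have := nondecreasing_cvgn_le nd (is_cvg_series_exp_coeff _) m.
  by rewrite {1}seriesEord.
rewrite exprMn mulrAC ler_wpM2r ?exprn_ge0// ler_wpM2l// ler_expR.
by rewrite ler_piMr.
Unshelve. all: by end_near. Qed.

End Exponential.

(** * Positive definite matrices *)

Section PositiveDefinite.
Variable R : realType.

Lemma posdefmx_block (m n : nat) (S : 'M[R]_m) (Q : 'M[R]_n) :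
  posdefmx S -> posdefmx Q -> posdefmx (block_mx S 0 0 Q).
Proof.
move=> [Ssym Spos] [Qsym Qpos]; split=> [|x x0].
  by rewrite tr_block_mx !trmx0 Ssym Qsym.
have [v [w E]] : exists v w, x = col_mx v w.
  by exists (usubmx x), (dsubmx x); rewrite vsubmxK.
rewrite E tr_col_mx mul_row_block mul_row_col !mulmx0 addr0 add0r mxE.
have ge0 k (T : 'M[R]_k) (z : 'cV_k) : posdefmx T -> 0 <= (z^T *m T *m z) 0 0.
  move=> [_ Tpos]; have [->|/Tpos/ltW//] := eqVneq z 0.
  by rewrite mulmx0 mxE.
have [v0|v0] := eqVneq v 0; last by rewrite ltr_pwDl ?Spos// ge0.
rewrite ltr_wpDl ?ge0// Qpos//.
by apply: contra_neq x0 => w0; rewrite E v0 w0 col_mx0.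
Qed.

Lemma posdefmx_sum (n k : nat) (b : 'I_k -> R) (S : 'I_k -> 'M[R]_n) :
  (0 < k)%N -> (forall i, 0 < b i) -> (forall i, posdefmx (S i)) ->
  posdefmx (\sum_i b i *: S i).
Proof.
move=> k0 b0 Spos; split=> [|x x0].
  by rewrite linear_sum; apply: eq_bigr => i _; rewrite linearZ /= (Spos i).1.
have xS i : 0 < (x^T *m (b i *: S i) *m x) 0 0.
  by rewrite -scalemxAr -scalemxAl mxE mulr_gt0// (Spos i).2.
rewrite mulmx_sumr mulmx_suml summxE (bigD1 (Ordinal k0))//= ltr_pwDl//.
by apply: sumr_ge0 => i _; exact: ltW.
Qed.

End PositiveDefinite.

(** * The quadratic form [v^T w] along the flow with constant coefficients *)

Section HamiltonianFlow.
Variables (R : realType) (n : nat) (a s q : 'M[R]_n).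
Hypotheses (spos : posdefmx s) (qpos : posdefmx q).

Let B : 'M[R]_(n + n) := block_mx (- a^T) (- q) (- s) a.
Let K : 'M[R]_(n + n) := block_mx 0 1%:M 0 0.
Let D : 'M[R]_(n + n) := block_mx s 0 0 q.

(** [K] represents the bilinear form [v^T w] on pairs [col_mx v w], and [D] its
    derivative along [y' = - B y]. *)
Lemma riccati_form_lyapunov : (- B)^T *m K + K *m (- B) = D.
Proof.
rewrite /B /K /D opp_block_mx !opprK tr_block_mx !mulmx_block linearN /= trmxK.
rewrite spos.1 qpos.1 !mulmx0 !mul0mx !mulmx1 !mul1mx !addr0 !add0r.
by rewrite add_block_mx !addr0 !add0r subrr.
Qed.

Lemma has_deriv_in_riccati_form (I : set R) (m : nat) (Z : 'M[R]_(n + n, m)) u :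
  let Y v := expm (v *: - B) *m Z in
  has_deriv_in I (fun v => (Y v)^T *m K *m Y v) ((Y u)^T *m D *m Y u) u.
Proof.
move=> Y; have dY : has_deriv_in I Y (- B *m Y u) u.
  have := has_deriv_in_mulmx (@has_deriv_in_expm _ _ I (- B) u)
    (@has_deriv_in_cst _ _ _ I Z u).
  by rewrite mulmx0 addr0 mulmxA.
have -> : (Y u)^T *m D *m Y u =
    ((- B *m Y u)^T *m K + (Y u)^T *m 0) *m Y u + ((Y u)^T *m K) *m (- B *m Y u).
  move: (Y u) => y; rewrite mulmx0 addr0 [(_ *m y)^T]trmx_mul.
  rewrite -riccati_form_lyapunov mulmxDr mulmxDl.
  by rewrite !mulmxA.
apply: has_deriv_in_mulmx => //; apply: has_deriv_in_mulmx.
  exact: has_deriv_in_tr dY.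
exact: has_deriv_in_cst.
Qed.

(** One backward step over [h > 0] with constant coefficients: it preserves the
    symmetry of [V^T W] and turns semidefiniteness of [V^T W], for an injective
    [col_mx V W], into definiteness. *)
Lemma riccati_step_form (m : nat) (h : R) (V W V' W' : 'M[R]_(n, m)) :
  0 < h -> col_mx V' W' = expm (h *: - B) *m col_mx V W ->
  V^T *m W = W^T *m V ->
  (forall x : 'cV_m, 0 <= (x^T *m (V^T *m W) *m x) 0 0) ->
  (forall x : 'cV_m, V *m x = 0 -> W *m x = 0 -> x = 0) ->
  V'^T *m W' = W'^T *m V' /\
  forall x : 'cV_m, x != 0 -> 0 < (x^T *m (V'^T *m W') *m x) 0 0.
Proof.
move=> h0 E sym psd inj.
have KE k (v w : 'M[R]_(n, k)) : (col_mx v w)^T *m K *m col_mx v w = v^T *m w.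
  rewrite tr_col_mx mul_row_block mul_row_col !mulmx0 !addr0 mulmx1.
  by rewrite mul0mx add0r.
have hD : `[0, h]%classic 0 /\ `[0, h]%classic h.
  by rewrite /= !in_itv /= !lexx ltW.
split.
(* The antisymmetric part of [V^T W] has zero derivative. *)
- pose F u := (expm (u *: - B) *m col_mx V W)^T *m K *m (expm (u *: - B) *m col_mx V W).
  have dF u := @has_deriv_in_riccati_form `[0, h] _ (col_mx V W) u.
  have dG u := has_deriv_inD (dF u) (has_deriv_inN (has_deriv_in_tr (dF u))).
  have : `|(F h - (F h)^T) - (F 0 - (F 0)^T)| <= 0 * `|h - 0|.
    apply: (mx_mean_value_le (fun u _ => dG u)) hD.2 hD.1 => u _.
    have [Dsym _] := posdefmx_block spos qpos.
    rewrite /=; move: (_ *m col_mx V W) => y.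
    by rewrite [X in _ - X]trmx_mul [(y^T *m D)^T]trmx_mul trmxK Dsym mulmxA subrr normr0.
  rewrite mul0r normr_le0 /F -E scale0r expm0 mul1mx !KE !trmx_mul !trmxK.
  by rewrite sym subrr subr0 subr_eq0 => /eqP.
- move=> x x0.
  have Ex : col_mx (V' *m x) (W' *m x) = expm (h *: - B) *m col_mx (V *m x) (W *m x).
    by rewrite -!mul_col_mx E mulmxA.
  have fE (v w : 'M[R]_(n, m)) : x^T *m (v^T *m w) *m x = (v *m x)^T *m (w *m x).
    by rewrite trmx_mul !mulmxA.
  have [c _] := mx_MVT 0 0 h0
    (fun u _ => @has_deriv_in_riccati_form `[0, h] _ (col_mx (V *m x) (W *m x)) u).
  rewrite -Ex scale0r expm0 mul1mx !KE -!fE => Fh.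
  rewrite -[ltRHS](subrK ((x^T *m (V^T *m W) *m x) 0 0)) Fh ltr_wpDr ?psd//.
  rewrite subr0 mulr_gt0//; apply: (posdefmx_block spos qpos).2.
  apply: contra_neq x0 => /(congr1 (mulmx (invmx (expm (c *: - B))))).
  rewrite mulKmx ?expm_unit// mulmx0 => /eqP; rewrite col_mx_eq0.
  by move=> /andP[/eqP Vx /eqP Wx]; exact: inj.
Qed.

End HamiltonianFlow.

(** * Preservation of positivity *)

Section PositivityPreservation.
Variables (R : realType) (n : nat).

(** [V W^-1 = (W^-1)^T (W^T V) W^-1] is congruent to [W^T V = V^T W]. *)
Lemma posdefmx_frame (V W : 'M[R]_n) : V^T *m W = W^T *m V ->
  (forall x : 'cV_n, x != 0 -> 0 < (x^T *m (V^T *m W) *m x) 0 0) ->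
  W \in unitmx /\ posdefmx (V *m invmx W).
Proof.
move=> sym pd.
have Wu : W \in unitmx.
  rewrite -unitmx_tr -row_free_unit; apply: inj_row_free => v vW.
  apply/eqP; apply: contraTT isT => v0.
  have := pd v^T; rewrite trmx_eq0 trmxK => /(_ v0).
  by rewrite -!mulmxA -[W *m _]trmxK trmx_mul trmxK vW trmx0 !mulmx0 mxE ltxx.
split=> //; split=> [|x x0].
  apply: (can_inj (mulmxK Wu)); rewrite mulmxKV//.
  by rewrite trmx_mul -mulmxA sym trmx_inv mulmxA mulVmx ?unitmx_tr// mul1mx.
have xE : x = W *m (invmx W *m x) by rewrite mulKVmx.
have y0 : invmx W *m x != 0.
  by apply: contra_neq x0 => y0; rewrite xE y0 mulmx0.
have := pd _ y0; rewrite sym.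
have -> : (invmx W *m x)^T *m (W^T *m V) *m (invmx W *m x) =
    (W *m (invmx W *m x))^T *m V *m (invmx W *m x).
  by rewrite [(W *m _)^T]trmx_mul !mulmxA.
by rewrite -xE !mulmxA.
Qed.

(** Any method whose step is the exponential of a constant matrix of Riccati
    type preserves positivity, whatever the step size. *)
Lemma preserves_positivity_expm (t0 tf : R) (Psi : R -> R -> 'M[R]_(n + n)) :
  t0 < tf ->
  (forall h t, 0 < h -> t0 <= t -> t + h <= tf -> exists a s q : 'M[R]_n,
     [/\ posdefmx s, posdefmx q &
         Psi h t = expm (h *: block_mx (- a^T) (- q) (- s) a)]) ->
  preserves_positivity t0 tf Psi.
Proof.
move=> t0tf HPsi N V W N0 h VN WN step.
have N0' : 0 < N%:R :> R by rewrite ltr0n.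
have h0 : 0 < h by rewrite divr_gt0// subr_gt0.
pose good j := (V j)^T *m W j = (W j)^T *m V j /\
  forall x : 'cV_n, x != 0 -> 0 < (x^T *m ((V j)^T *m W j) *m x) 0 0.
have one j : (j < N)%N -> (V j.+1)^T *m W j.+1 = (W j.+1)^T *m V j.+1 ->
  (forall x : 'cV_n, 0 <= (x^T *m ((V j.+1)^T *m W j.+1) *m x) 0 0) ->
  (forall x : 'cV_n, V j.+1 *m x = 0 -> W j.+1 *m x = 0 -> x = 0) -> good j.
  move=> jN; have [||a [s [q [spos qpos PsiE]]]] := HPsi h (t0 + j%:R * h) h0.
  - by rewrite lerDl mulr_ge0// ltW.
  - have -> : tf = t0 + N%:R * h by rewrite /h mulrC divfK ?gt_eqF// addrC subrK.
    have E : j%:R * h + h = j.+1%:R * h by rewrite -natr1 mulrDl mul1r.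
    by rewrite -addrA E lerD2l ler_pM2r// ler_nat.
  apply: (riccati_step_form spos qpos h0).
  by rewrite (step j jN) PsiE invmx_expm -scalerN.
(* Backward induction on [j], phrased through [d = N - j - 1]; the terminal pair
   is only semidefinite but [col_mx 0 1] is injective. *)
suff goodP d j : (j + d.+1)%N = N -> good j.
  move=> j jN; have jd : (j + (N - j.+1).+1)%N = N by rewrite addnS -addSn subnKC.
  by have [sym pd] := goodP _ _ jd; exact: posdefmx_frame.
elim: d j => [|d IH] j jd.
- have jN : j.+1 = N by rewrite -jd addn1.
  apply: one; first by rewrite -jN.
  + by rewrite jN VN WN trmx0 mul0mx mulmx0.
  + by move=> x; rewrite jN VN trmx0 mul0mx mulmx0 mul0mx mxE.
  + by move=> x; rewrite jN WN mul1mx.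
- have jd' : (j.+1 + d.+1)%N = N by rewrite addSnnS.
  have [sym pd] := IH _ jd'.
  apply: one => //; first by rewrite -jd addnS ltnS leq_addr.
  + move=> x; have [->|/pd/ltW//] := eqVneq x 0; by rewrite mulmx0 mxE.
  + move=> x _ Wx; apply/eqP; apply: contraT => /pd.
    by rewrite -!mulmxA Wx !mulmx0 mxE ltxx.
Qed.

Lemma sum_block_mx (I : Type) (r : seq I) (m1 m2 n1 n2 : nat)
    (Aul : I -> 'M[R]_(m1, n1)) (Aur : I -> 'M[R]_(m1, n2))
    (Adl : I -> 'M[R]_(m2, n1)) (Adr : I -> 'M[R]_(m2, n2)) :
  \sum_(i <- r) block_mx (Aul i) (Aur i) (Adl i) (Adr i) =
  block_mx (\sum_(i <- r) Aul i) (\sum_(i <- r) Aur i)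
           (\sum_(i <- r) Adl i) (\sum_(i <- r) Adr i).
Proof.
elim: r => [|i r IH]; first by rewrite !big_nil block_mx0.
by rewrite !big_cons IH add_block_mx.
Qed.

Lemma riccati_mx_sum (A S Q : R -> 'M[R]_n) (k : nat) (b t : 'I_k -> R) :
  \sum_(i < k) b i *: riccati_mx A S Q (t i) =
  block_mx (- (\sum_i b i *: A (t i))^T) (- \sum_i b i *: Q (t i))
           (- \sum_i b i *: S (t i)) (\sum_i b i *: A (t i)).
Proof.
rewrite [(\sum_i _)^T]raddf_sum -!sumrN -sum_block_mx; apply: eq_bigr => i _.
by rewrite /= [(b i *: _)^T]linearZ /riccati_mx scale_block_mx !scalerN.
Qed.

Lemma magnus_step_preserves_positivity (t0 tf : R) (A S Q : R -> 'M[R]_n)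
    (k : nat) (c b : 'I_k -> R) :
  t0 < tf ->
  (forall t, t0 <= t <= tf -> posdefmx (S t)) ->
  (forall t, t0 <= t <= tf -> posdefmx (Q t)) ->
  quadrature_order2 c b ->
  preserves_positivity t0 tf (magnus_step c b (riccati_mx A S Q)).
Proof.
move=> t0tf Spos Qpos [c01 b0 b1 _]; apply: preserves_positivity_expm => //.
move=> h t h0 t0t thtf.
have k0 : (0 < k)%N.
  case: k c b c01 b0 b1 => // c b _ _ /eqP.
  by rewrite big_ord0 eq_sym oner_eq0.
have node i : t0 <= t + c i * h <= tf.
  have /andP[c0 c1] := c01 i; apply/andP; split.
    by rewrite (le_trans t0t)// lerDl mulr_ge0// ltW.
  by rewrite (le_trans _ thtf)// lerD2l ler_piMl// ltW.
exists (\sum_i b i *: A (t + c i * h)), (\sum_i b i *: S (t + c i * h)),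
  (\sum_i b i *: Q (t + c i * h)); split.
- by apply: posdefmx_sum => // i; exact: Spos.
- by apply: posdefmx_sum => // i; exact: Qpos.
- by rewrite /magnus_step (riccati_mx_sum A S Q b (fun i => t + c i * h)).
Qed.

End PositivityPreservation.

(** * Second order expansions *)

Section LinearODE.
Variables (R : realType) (p : nat).

(** Taylor estimates of order 0 and 1 around [t], on a segment all of whose
    points are at distance at most [d] from [t]. *)
Lemma mx_taylor0 (m n : nat) (a b t d C : R) (f df : R -> 'M[R]_(m, n)) :
  (forall s, `[a, b]%classic s -> has_deriv_in `[a, b]%classic f (df s) s) ->
  (forall s, `[a, b]%classic s -> `|df s| <= C) ->
  `[a, b]%classic t -> (forall s, `[a, b]%classic s -> `|s - t| <= d) ->
  forall s, `[a, b]%classic s -> `|f s - f t| <= C * d.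
Proof.
move=> fdf dfC tI Id s sI; have C0 : 0 <= C by exact: le_trans (dfC s sI).
by apply: le_trans (mx_mean_value_le fdf dfC sI tI) _; rewrite ler_wpM2l// Id.
Qed.

Lemma mx_taylor1 (m n : nat) (a b t d C : R) (f f1 f2 : R -> 'M[R]_(m, n)) :
  (forall s, `[a, b]%classic s -> has_deriv_in `[a, b]%classic f (f1 s) s) ->
  (forall s, `[a, b]%classic s -> has_deriv_in `[a, b]%classic f1 (f2 s) s) ->
  (forall s, `[a, b]%classic s -> `|f2 s| <= C) ->
  `[a, b]%classic t -> (forall s, `[a, b]%classic s -> `|s - t| <= d) ->
  forall s, `[a, b]%classic s -> `|f s - f t - (s - t) *: f1 t| <= C * d * d.
Proof.
move=> ff1 f12 f2C tI Id s sI.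
have dF y : `[a, b]%classic y -> has_deriv_in `[a, b]%classic
    (fun y => f y - (y - t) *: f1 t) (f1 y - (f1 t + (y - t) *: 0)) y.
  move=> yI; apply: has_deriv_inD (ff1 y yI) _; apply: has_deriv_inN.
  by apply: has_deriv_in_scale_shift; exact: has_deriv_in_cst.
have := mx_taylor0 dF _ tI Id sI; rewrite subrr scale0r subr0 addrAC; apply.
by move=> y yI; rewrite scaler0 addr0; exact: (mx_taylor0 f12 f2C tI Id yI).
Qed.

(** The second order expansion of the fundamental solution around [t].  The
    smallness condition on [d] replaces Gronwall's lemma in bounding [Y]; [c * d] and
    [c' * d * d] bound the errors of the expansions of order 0 and 1. *)
Lemma linear_ode_taylor2 (a b t d K : R) (M M1 M2 Y : R -> 'M[R]_p) :
  (forall s, `[a, b]%classic s -> has_deriv_in `[a, b]%classic M (M1 s) s) ->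
  (forall s, `[a, b]%classic s -> has_deriv_in `[a, b]%classic M1 (M2 s) s) ->
  (forall s, `[a, b]%classic s -> has_deriv_in `[a, b]%classic Y (M s *m Y s) s) ->
  (forall s, `[a, b]%classic s -> [/\ `|M s| <= K, `|M1 s| <= K & `|M2 s| <= K]) ->
  `[a, b]%classic t -> (forall s, `[a, b]%classic s -> `|s - t| <= d) ->
  p%:R * K * d <= 2^-1 -> Y t = 1%:M ->
  let c := 2 * p%:R * K in
  let c' := c + p%:R * K * c in
  forall s, `[a, b]%classic s ->
  `|Y s - (1%:M + (s - t) *: M t
       + 2^-1 *: ((s - t) ^+ 2 *: (M1 t + M t *m M t)))| <=
    (c + p%:R * K * c' + p%:R * K * c) * d ^+ 3.
Proof.
move=> dM dM1 dY bM tI Id small Yt c c' s sI.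
have K0 : 0 <= K by have [+ _ _] := bM t tI; exact: le_trans.
have d0 : 0 <= d by exact: le_trans (Id t tI).
have mv (f df : R -> 'M[R]_p) C fdf dfC := @mx_taylor0 _ _ a b t d C f df fdf dfC tI Id.
have Md x : `[a, b]%classic x -> `|M x - M t| <= K * d.
  by apply: mv dM _ x => x /bM[].
have Mdd x : `[a, b]%classic x -> `|M x - M t - (x - t) *: M1 t| <= K * d * d.
  by apply: mx_taylor1 dM dM1 _ tI Id _ => y /bM[].
have ab : a <= b.
  by move: tI; rewrite /= in_itv /= => /andP[]; exact: le_trans.
(* At a maximum point [x0] of [`|Y|], [`|Y x0| <= 1 + `|Y x0| / 2]. *)
have Y2 x : `[a, b]%classic x -> `|Y x| <= 2.
  have [x0 x0I maxY] :=
    within_continuous_mx_bounded ab (has_deriv_in_within_continuous dY).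
  suff Y0 : `|Y x0| <= 2 by move=> /maxY /le_trans; apply.
  have H : `|Y x0 - 1%:M| <= 2^-1 * `|Y x0|.
    apply: (@le_trans _ _ (p%:R * K * `|Y x0| * d)); last by rewrite mulrAC ler_wpM2r.
    rewrite -Yt; apply: (mv _ _ _ dY _ _ x0I) => y yI.
    by apply: ler_norm_mulmx_le (maxY y yI); have [] := bM y yI.
  have := ler_normD (Y x0 - 1%:M) 1%:M; rewrite subrK.
  have := ler_norm_scalar_mx1 R p; lra.
have Y1 x : `[a, b]%classic x -> `|Y x - 1%:M| <= c * d.
  rewrite -Yt; apply: mv dY _ x => x xI.
  have -> : c = p%:R * K * 2 by rewrite /c; ring.
  by apply: ler_norm_mulmx_le (Y2 x xI); have [] := bM x xI.
have Yd x : `[a, b]%classic x -> `|Y x - 1%:M - (x - t) *: M t| <= c' * d * d.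
  move=> xI.
  have dF y : `[a, b]%classic y -> has_deriv_in `[a, b]%classic
      (fun y => Y y - (y - t) *: M t) (M y *m Y y - (M t + (y - t) *: 0)) y.
    move=> yI; apply: has_deriv_inD (dY y yI) _; apply: has_deriv_inN.
    by apply: has_deriv_in_scale_shift; exact: has_deriv_in_cst.
  have := mv _ _ (c' * d) dF _ x xI; rewrite subrr scale0r subr0 Yt addrAC; apply.
  move=> y yI; rewrite scaler0 addr0.
  have -> : M y *m Y y - M t = (M y - M t) *m Y y + M t *m (Y y - 1%:M).
    by rewrite mulmxBl mulmxBr mulmx1 addrA subrK.
  rewrite (le_trans (ler_normD _ _))//.
  have -> : c' * d = p%:R * (K * d) * 2 + p%:R * K * (c * d).
    by rewrite /c' /c; ring.
  rewrite lerD//; first by apply: ler_norm_mulmx_le; [exact: Md | exact: Y2].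
  by apply: ler_norm_mulmx_le; [have [] := bM t tI | exact: Y1].
(* [F] is [Y] minus the nonconstant part of its expansion; its derivative is
   quadratically small in [d]. *)
pose N := M1 t + M t *m M t; pose N2 := 2^-1 *: N.
pose F y := Y y - (y - t) *: (M t + (y - t) *: N2).
have dF y : `[a, b]%classic y -> has_deriv_in `[a, b]%classic F
    (M y *m Y y - (M t + (y - t) *: N2 + (y - t) *: (0 + (N2 + (y - t) *: 0)))) y.
  move=> yI; apply: has_deriv_inD (dY y yI) _; apply: has_deriv_inN.
  apply: has_deriv_in_scale_shift; apply: has_deriv_inD; first exact: has_deriv_in_cst.
  by apply: has_deriv_in_scale_shift; exact: has_deriv_in_cst.
have FE : F s - F t = Y s - (1%:M + (s - t) *: M t + 2^-1 *: ((s - t) ^+ 2 *: N)).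
  rewrite /F /N2 subrr scale0r subr0 Yt.
  by apply/matrixP => i j; rewrite ![in LHS]mxE ![in RHS]mxE; field.
rewrite -FE exprSr mulrA.
apply: (mv _ _ _ dF _ _ sI) => y yI.
set r := y - t.
have rd : `|r| <= d by exact: Id.
have -> : M y *m Y y - (M t + r *: N2 + r *: (0 + (N2 + r *: 0))) =
   (M y - M t - r *: M1 t) *m Y y + M t *m (Y y - 1%:M - r *: M t) +
   r *: (M1 t *m (Y y - 1%:M)).
  rewrite !(mulmxBl, mulmxBr) !mulmx1 -!(scalemxAl, scalemxAr) /N2 /N.
  move: (M t *m M t) (M y *m Y y) (M t *m Y y) (M1 t *m Y y) => Z1 Z2 Z3 Z4.
  by apply/matrixP => i j; rewrite !mxE; field.
have -> : (c + p%:R * K * c' + p%:R * K * c) * d ^+ 2 =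
  p%:R * (K * d * d) * 2 + p%:R * K * (c' * d * d) + d * (p%:R * K * (c * d)).
  by rewrite /c; ring.
rewrite (le_trans (ler_normD _ _))// lerD//.
  rewrite (le_trans (ler_normD _ _))// lerD//.
    by apply: ler_norm_mulmx_le; [exact: Mdd | exact: Y2].
  by apply: ler_norm_mulmx_le; [have [] := bM t tI | exact: Yd].
rewrite normrZ ler_pM//.
by apply: ler_norm_mulmx_le; [have [] := bM t tI | exact: Y1].
Qed.

Lemma ler_norm_average (k : nat) (b : 'I_k -> R) (f : 'I_k -> 'M[R]_p) C :
  (forall i, 0 < b i) -> \sum_i b i = 1 -> (forall i, `|f i| <= C) ->
  `|\sum_i b i *: f i| <= C.
Proof.
move=> b0 b1 fC; rewrite (le_trans (ler_norm_sum _ _ _))//.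
rewrite -[leRHS]mul1r -b1 mulr_suml; apply: ler_sum => i _.
by rewrite normrZ gtr0_norm// ler_pM2l.
Qed.

(** The Magnus step has the same second order expansion, with [M1] playing the
    role of [M' t]. *)
Lemma magnus_step_taylor2 (k : nat) (c b : 'I_k -> R) (M : R -> 'M[R]_p)
    (M1 : 'M[R]_p) (t h K : R) :
  quadrature_order2 c b -> `|M t| <= K ->
  (forall i, `|M (t + c i * h)| <= K) ->
  (forall i, `|M (t + c i * h) - M t| <= K * `|h|) ->
  (forall i, `|M (t + c i * h) - M t - (c i * h) *: M1| <= K * `|h| * `|h|) ->
  K * `|h| <= 1 ->
  `|magnus_step c b M h t -
    (1%:M + h *: M t + 2^-1 *: (h ^+ 2 *: (M1 + M t *m M t)))| <=
  (K + p%:R * K ^+ 2 + p%:R ^+ 3 * expR p%:R * K ^+ 3) * `|h| ^+ 3.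
Proof.
move=> [_ b0 b1 bc] MtK MK Md Mdd Kh.
rewrite /magnus_step; set X := h *: _.
have K0 : 0 <= K by exact: le_trans MtK.
have XK : `|X| <= K * `|h|.
  by rewrite /X normrZ mulrC ler_wpM2r//; exact: ler_norm_average.
have XM : `|X - h *: M t| <= K * `|h| * `|h|.
  have -> : X - h *: M t = h *: \sum_i b i *: (M (t + c i * h) - M t).
    under eq_bigr do rewrite scalerBr.
    by rewrite sumrB -scaler_suml b1 scale1r scalerBr.
  by rewrite normrZ mulrC ler_wpM2r//; exact: ler_norm_average.
have XM1 : `|X - h *: M t - 2^-1 *: (h ^+ 2 *: M1)| <= K * `|h| * `|h| * `|h|.
  have -> : X - h *: M t - 2^-1 *: (h ^+ 2 *: M1) =
      h *: \sum_i b i *: (M (t + c i * h) - M t - (c i * h) *: M1).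
    under eq_bigr do rewrite !scalerBr !scalerA mulrA.
    rewrite !sumrB -!scaler_suml b1 bc !scalerBr scale1r.
    rewrite [2^-1 *: h]mulrC !scalerA; congr (_ - _ *: _).
    by field.
  by rewrite normrZ mulrC ler_wpM2r//; exact: ler_norm_average.
clearbody X; have XX : `|2^-1 *: (X *m X - h ^+ 2 *: (M t *m M t))| <=
    p%:R * K ^+ 2 * `|h| ^+ 3.
  have -> : X *m X - h ^+ 2 *: (M t *m M t) =
      (X - h *: M t) *m X + (h *: M t) *m (X - h *: M t).
    rewrite mulmxBl mulmxBr -!(scalemxAl, scalemxAr) scalerA -expr2.
    by rewrite addrA subrK.
  rewrite normrZ gtr0_norm ?invr_gt0// mulrC ler_pdivrMr//.
  rewrite (le_trans (ler_normD _ _))//.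
  have -> : p%:R * K ^+ 2 * `|h| ^+ 3 * 2 =
    p%:R * (K * `|h| * `|h|) * (K * `|h|) + p%:R * (K * `|h|) * (K * `|h| * `|h|).
    by ring.
  rewrite lerD//; apply: ler_norm_mulmx_le => //.
  by rewrite normrZ mulrC ler_wpM2r.
have XE := expm_taylor2 (le_trans XK Kh).
(* Split into the quadrature error, the error in the quadratic term and the
   remainder of the exponential series. *)
have -> : expm X - (1%:M + h *: M t + 2^-1 *: (h ^+ 2 *: (M1 + M t *m M t))) =
    (X - h *: M t - 2^-1 *: (h ^+ 2 *: M1)) +
    2^-1 *: (X *m X - h ^+ 2 *: (M t *m M t)) +
    (expm X - (1%:M + X + 2^-1 *: (X *m X))).
  move: (expm X) (X *m X) (M t *m M t) => Z1 Z2 Z3.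
  by apply/matrixP => i j; rewrite !mxE; field.
rewrite (le_trans (ler_normD _ _))// !mulrDl lerD//.
  rewrite (le_trans (ler_normD _ _))// lerD//.
  by rewrite (le_trans XM1)// !exprS expr0 mulr1 !mulrA.
rewrite (le_trans XE)// -[leRHS]mulrA -exprMn ler_wpM2l//.
by rewrite lerXn2r// nnegrE ?mulr_ge0.
Qed.

Lemma magnus_step_second_order (t0 tf : R) (M : R -> 'M[R]_p)
    (k : nat) (c b : 'I_k -> R) :
  t0 <= tf -> C2_in `[t0, tf] M -> quadrature_order2 c b ->
  second_order t0 tf M (magnus_step c b M).
Proof.
move=> t0tf [M1 [M2 [dM dM1 M2c]]] qcb Phi fundPhi.
have [x0 x0I H0] :=
  within_continuous_mx_bounded t0tf (has_deriv_in_within_continuous dM).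
have [x1 x1I H1] :=
  within_continuous_mx_bounded t0tf (has_deriv_in_within_continuous dM1).
have [x2 x2I H2] := within_continuous_mx_bounded t0tf M2c.
pose K := `|M x0| + `|M1 x1| + `|M2 x2|.
have K0 : 0 <= K by rewrite !addr_ge0.
have bM s : `[t0, tf]%classic s -> [/\ `|M s| <= K, `|M1 s| <= K & `|M2 s| <= K].
  have := normr_ge0 (M x0); have := normr_ge0 (M1 x1); have := normr_ge0 (M2 x2).
  by move=> ? ? ? sI; split;
    [have := H0 s sI | have := H1 s sI | have := H2 s sI]; rewrite /K; lra.
pose c1 : R := 2 * p%:R * K.
pose c2 := c1 + p%:R * K * c1.
exists ((K + p%:R * K ^+ 2 + p%:R ^+ 3 * expR p%:R * K ^+ 3) +
  (c1 + p%:R * K * c2 + p%:R * K * c1)).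
have e0 : 0 < 2 * ((p%:R + 1) * (K + 1)) :> R by rewrite !mulr_gt0// ltr_wpDl.
near=> h => t tI uI.
have he : `|h| * (2 * ((p%:R + 1) * (K + 1))) <= 1.
  rewrite -ler_pdivlMr// mul1r ltW//; near: h; exists (2 * ((p%:R + 1) * (K + 1)))^-1.
    by rewrite /= invr_gt0.
  by move=> x /=; rewrite sub0r normrN.
have p0 : 0 <= p%:R :> R by [].
have pKh : p%:R * K * `|h| <= 2^-1.
  have := mulr_ge0 p0 (normr_ge0 h); have := mulr_ge0 K0 (normr_ge0 h).
  have := normr_ge0 h; lra.
have Kh : K * `|h| <= 1.
  have := mulr_ge0 (mulr_ge0 p0 K0) (normr_ge0 h).
  have := mulr_ge0 p0 (normr_ge0 h); have := normr_ge0 h; lra.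
pose I := `[Num.min t (t + h), Num.max t (t + h)]%classic.
(* The step [h] may have either sign, so [t] is either endpoint of [I]. *)
have IE s : I s -> t0 <= s <= tf /\ `|s - t| <= `|h|.
  rewrite /I /= in_itv /=; move: tI uI; case: (leP t (t + h)) => hs.
    have h0 : 0 <= h by rewrite -(lerDl t).
    rewrite (ger0_norm h0) => tI uI /andP[ts su]; rewrite ger0_norm ?subr_ge0//.
    by split; lra.
  have h0 : h < 0 by rewrite -(gtrDl t).
  rewrite (ltr0_norm h0) => tI uI /andP[ts su]; rewrite ler0_norm ?subr_le0//.
  by split; lra.
have ID : I `<=` `[t0, tf]%classic.
  by move=> s /IE[sI _]; rewrite /= in_itv.
have Id s : I s -> `|s - t| <= `|h| by case/IE.
have It : I t by rewrite /I /= in_itv /= ge_min le_max lexx.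
have Iu : I (t + h) by rewrite /I /= in_itv /= ge_min le_max lexx !orbT.
have Inode i : I (t + c i * h).
  have [c01 _ _ _] := qcb; have /andP[ci0 ci1] := c01 i.
  rewrite /I /= in_itv /=; case: (leP t (t + h)) => hs.
    have h0 : 0 <= h by rewrite -(lerDl t).
    by rewrite lerDl lerD2l mulr_ge0//= ler_piMl.
  have h0 : h <= 0 by rewrite -(gerDl t) ltW.
  by rewrite gerDl lerD2l mulr_ge0_le0// ler_niMl.
have sub (f : R -> 'M[R]_p) (df : R -> 'M[R]_p) :
    (forall s, `[t0, tf]%classic s -> has_deriv_in `[t0, tf]%classic f (df s) s) ->
    forall s, I s -> has_deriv_in I f (df s) s.
  by move=> fdf s sI; exact: has_deriv_in_sub ID (fdf s (ID s sI)).
have [Ptt dP] := fundPhi t (ID _ It).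
have HP := linear_ode_taylor2 (sub _ _ dM) (sub _ _ dM1) (sub _ _ dP)
  (fun s sI => bM s (ID s sI)) It Id pKh Ptt Iu.
have bMI s (sI : I s) := bM s (ID s sI).
have HM : `|magnus_step c b M h t -
    (1%:M + h *: M t + 2^-1 *: (h ^+ 2 *: (M1 t + M t *m M t)))| <=
    (K + p%:R * K ^+ 2 + p%:R ^+ 3 * expR p%:R * K ^+ 3) * `|h| ^+ 3.
  apply: magnus_step_taylor2 => // [|i|i|i].
  - by have [] := bMI t It.
  - by have [] := bMI _ (Inode i).
  - by apply: (mx_taylor0 (sub _ _ dM) _ It Id (Inode i)) => s /bMI[].
  - rewrite -[X in X *: M1 t](addrK t) [_ * _ + t]addrC.
    by apply: (mx_taylor1 (sub _ _ dM) (sub _ _ dM1) _ It Id (Inode i)) => s /bMI[].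
move: HP; rewrite [t + h - t]addrC addKr => HP.
set T := 1%:M + _ + _ in HP HM.
rewrite -[_ - _](subrKA T) mulrDl (le_trans (ler_normD _ _))// lerD//.
by rewrite distrC.
Unshelve. all: by end_near. Qed.

End LinearODE.

(** * Regularity of the coefficient matrix *)

Section RiccatiRegularity.
Variable R : realType.

Lemma cvg_block_mx (T : Type) (F : set_system T) {FF : Filter F} (m1 m2 n1 n2 : nat)
    (f1 : T -> 'M[R]_(m1, n1)) (f2 : T -> 'M[R]_(m1, n2))
    (f3 : T -> 'M[R]_(m2, n1)) (f4 : T -> 'M[R]_(m2, n2))
    (g1 : 'M[R]_(m1, n1)) (g2 : 'M[R]_(m1, n2))
    (g3 : 'M[R]_(m2, n1)) (g4 : 'M[R]_(m2, n2)) :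
  f1 x @[x --> F] --> g1 -> f2 x @[x --> F] --> g2 ->
  f3 x @[x --> F] --> g3 -> f4 x @[x --> F] --> g4 ->
  block_mx (f1 x) (f2 x) (f3 x) (f4 x) @[x --> F] --> block_mx g1 g2 g3 g4.
Proof.
move=> /cvg_mxP H1 /cvg_mxP H2 /cvg_mxP H3 /cvg_mxP H4; apply/cvg_mxP => i j.
case: (split_ordP i) => i' ->; case: (split_ordP j) => j' ->.
- by rewrite block_mxEul; under eq_fun do rewrite block_mxEul; exact: H1.
- by rewrite block_mxEur; under eq_fun do rewrite block_mxEur; exact: H2.
- by rewrite block_mxEdl; under eq_fun do rewrite block_mxEdl; exact: H3.
- by rewrite block_mxEdr; under eq_fun do rewrite block_mxEdr; exact: H4.
Qed.

Lemma has_deriv_in_block (m1 m2 n1 n2 : nat) (D : set R) (t : R)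
    (f1 : R -> 'M[R]_(m1, n1)) (f2 : R -> 'M[R]_(m1, n2))
    (f3 : R -> 'M[R]_(m2, n1)) (f4 : R -> 'M[R]_(m2, n2)) g1 g2 g3 g4 :
  has_deriv_in D f1 g1 t -> has_deriv_in D f2 g2 t ->
  has_deriv_in D f3 g3 t -> has_deriv_in D f4 g4 t ->
  has_deriv_in D (fun s => block_mx (f1 s) (f2 s) (f3 s) (f4 s))
    (block_mx g1 g2 g3 g4) t.
Proof.
move=> d1 d2 d3 d4; rewrite /has_deriv_in.
under eq_fun do rewrite opp_block_mx add_block_mx scale_block_mx.
exact: cvg_block_mx.
Qed.

Lemma C2_in_riccati_mx (n : nat) (D : set R) (A S Q : R -> 'M[R]_n) :
  C2_in D A -> C2_in D S -> C2_in D Q -> C2_in D (riccati_mx A S Q).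
Proof.
move=> [A1 [A2 [dA dA1 cA]]] [S1 [S2 [dS dS1 cS]]] [Q1 [Q2 [dQ dQ1 cQ]]].
exists (riccati_mx A1 S1 Q1), (riccati_mx A2 S2 Q2); split.
- move=> t Dt; apply: has_deriv_in_block; last exact: dA.
  + by apply: has_deriv_inN; apply: has_deriv_in_tr; exact: dA.
  + by apply: has_deriv_inN; exact: dQ.
  + by apply: has_deriv_inN; exact: dS.
- move=> t Dt; apply: has_deriv_in_block; last exact: dA1.
  + by apply: has_deriv_inN; apply: has_deriv_in_tr; exact: dA1.
  + by apply: has_deriv_inN; exact: dQ1.
  + by apply: has_deriv_inN; exact: dS1.
- move=> t; apply: cvg_block_mx; last exact: cA.
  + apply: cvgN; have /cvg_mxP cAt := cA t; apply/cvg_mxP => i j.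
    by rewrite mxE; under eq_fun do rewrite mxE; exact: cAt.
  + by apply: cvgN; exact: cQ.
  + by apply: cvgN; exact: cS.
Qed.

End RiccatiRegularity.

(** * The midpoint and trapezoidal rules *)

Section SpecialRules.
Variables (R : realType) (n : nat) (M : R -> 'M[R]_n).

Lemma midpoint_quadrature :
  quadrature_order2 (fun _ : 'I_1 => 2^-1 : R) (fun=> 1).
Proof.
split=> //; rewrite ?big_ord1 ?mul1r// => _.
by rewrite invr_ge0 ler0n invf_le1// ler1n.
Qed.

Lemma midpoint_stepE :
  midpoint_step M = magnus_step (fun _ : 'I_1 => 2^-1) (fun=> 1) M.
Proof.
apply/funext => h; apply/funext => t.
by rewrite /midpoint_step /magnus_step big_ord1 scale1r [h / 2]mulrC.
Qed.

Lemma trapezoidal_quadrature :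
  quadrature_order2 (fun i : 'I_2 => (i%:R : R)) (fun=> 2^-1).
Proof.
split=> [i|//||].
- by rewrite ler0n lern1 -ltnS ltn_ord.
- by rewrite big_ord_recl big_ord1 -[2^-1]mul1r -splitr.
- by rewrite big_ord_recl big_ord1 /= mulr0 add0r mulr1.
Qed.

Lemma trapezoidal_stepE :
  trapezoidal_step M = magnus_step (fun i : 'I_2 => i%:R) (fun=> 2^-1) M.
Proof.
apply/funext => h; apply/funext => t.
rewrite /trapezoidal_step /magnus_step big_ord_recl big_ord1 /= mul0r addr0.
by rewrite mul1r -scalerDr scalerA addrC.
Qed.

End SpecialRules.

Unset Implicit Arguments.

Theorem mainTheorem2 (R : realType) (n : nat) (t0 tf : R)
    (A S Q : R -> 'M[R]_n)
    (ht : t0 < tf)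
    (hA : C2_in `[t0, tf] A) (hS : C2_in `[t0, tf] S) (hQ : C2_in `[t0, tf] Q)
    (hSpos : forall t, t0 <= t <= tf -> posdefmx (S t))
    (hQpos : forall t, t0 <= t <= tf -> posdefmx (Q t)) :
  let M := riccati_mx A S Q in
  [/\ forall (k : nat) (c b : 'I_k -> R), quadrature_order2 c b ->
        second_order t0 tf M (magnus_step c b M) /\
        preserves_positivity t0 tf (magnus_step c b M),
      second_order t0 tf M (midpoint_step M) /\
      preserves_positivity t0 tf (midpoint_step M)
    & second_order t0 tf M (trapezoidal_step M) /\
      preserves_positivity t0 tf (trapezoidal_step M)].
Proof.
move=> M.
have CM : C2_in `[t0, tf] M by exact: C2_in_riccati_mx.
have main k (c b : 'I_k -> R) : quadrature_order2 c b ->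
    second_order t0 tf M (magnus_step c b M) /\
    preserves_positivity t0 tf (magnus_step c b M).
  move=> qcb; split; first exact: magnus_step_second_order (ltW ht) CM qcb.
  exact: magnus_step_preserves_positivity.
split=> //.
- by rewrite midpoint_stepE; apply: main; exact: midpoint_quadrature.
- by rewrite trapezoidal_stepE; apply: main; exact: trapezoidal_quadrature.
Qed.
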